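(* Let $r(x,x^* )=c^*\bigl(K-\sum_{j=1}^g B_jx_j-\sum_{j=1}^g B_j^*x_j^*\bigr)^{-1}c$ be a minimal symmetric descriptor realization of size $d$. Let $P$ and $P_*$ denote the orthogonal projections of $\mathbb C^d$ onto $\operatorname{rng}B$ and $\operatorname{rng}B^*$ respectively. Then $r$ is plush in a neighborhood of $0$ if and only if $PKP$ and $P_*KP_*$ are both positive semidefinite.
   Context: Symmetric descriptor realization: $K\in M_d(\mathbb C)$ is a signature matrix ($K=K^*$, $K^2=I_d$), $B=(B_1,\dots,B_g)\in M_d(\mathbb C)^g$, $c\in\mathbb C^d$. For $X\in M_n(\mathbb C)^g$ put $\Lambda_B(X)=\sum_j B_j\otimes X_j$ and $\Lambda_B(X)^*=\sum_jB_j^*\otimes X_j^*$. The domain consists of those $X$ for which $K\otimes I_n-\Lambda_B(X)-\Lambda_B(X)^*$ is invertible; then $\Delta(X)$ is the inverse and $r(X,X^* )=(c\otimes I_n)^*\Delta(X)(c\otimes I_n)$. Minimal: $\operatorname{span}\{w(B_1K,\dots,B_gK,B_1^*K,\dots,B_g^*K)c\}=\mathbb C^d$, where $w$ ranges over all words (including the empty word) in $2g$ freely noncommuting letters. $\operatorname{rng}B$ is the span of the ranges of $B_1,\dots,B_g$, and $\operatorname{rng}B^*$ is the span of the ranges of $B_1^*,\dots,B_g^*$. Free ball: $\mathbb B_\varepsilon(n)=\{X\in M_n(\mathbb C)^g:\sum_j X_j^*X_j\prec\varepsilon^2 I_n\}$, $\mathbb B_\varepsilon=(\mathbb B_\varepsilon(n))_n$.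 Plush: with $C=c\otimes I_n$, the complex Hessian of $r$ is $$r_{x,x^*}(X,X^* )[H,H^*]=C^*\Delta(X)\Lambda_B(H)^*\Delta(X)\Lambda_B(H)\Delta(X)C+C^*\Delta(X)\Lambda_B(H)\Delta(X)\Lambda_B(H)^*\Delta(X)C.$$ $r$ is plush in a neighborhood of $0$ if there is $\varepsilon>0$ such that $\mathbb B_\varepsilon$ lies in the domain and $r_{x,x^*}(X,X^* )[H,H^*]\succeq0$ for all $n$, $X\in\mathbb B_\varepsilon(n)$ and $H\in M_n(\mathbb C)^g$. *)

(* Defs.v *)
From HB Require Import structures.
From mathcomp Require Import all_boot all_order all_algebra.
From mathcomp Require Import complex mxtens.
From mathcomp Require Import reals.

Set Implicit Arguments.
Unset Strict Implicit.
Unset Printing Implicit Defensive.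

Import Order.TTheory GRing.Theory Num.Theory.
Local Open Scope ring_scope.
Local Open Scope sesquilinear_scope.
Local Open Scope complex_scope.

Section MatrixNotions.
Variable C : numClosedFieldType.

Definition psdmx (n : nat) (A : 'M[C]_n) : Prop :=
  A \is hermsymmx /\ forall v : 'cV[C]_n, 0 <= (v ^t* *m A *m v) 0 0.

Definition pdmx (n : nat) (A : 'M[C]_n) : Prop :=
  A \is hermsymmx /\ forall v : 'cV[C]_n, v != 0 -> 0 < (v ^t* *m A *m v) 0 0.

(* Matrices act on column vectors, so these are column spaces, unlike the
   row spaces of mxalgebra. *)
Definition mxrng (d : nat) (A : 'M[C]_d) : {vspace 'cV[C]_d} :=
  limg (linfun (mulmx A : 'cV[C]_d -> 'cV[C]_d)).

Definition famrng (d g : nat) (B : 'I_g -> 'M[C]_d) : {vspace 'cV[C]_d} :=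
  (\sum_(j < g) mxrng (B j))%VS.

Definition is_orthoproj (d : nat) (P : 'M[C]_d) (V : {vspace 'cV[C]_d}) : Prop :=
  [/\ P \is hermsymmx, P *m P = P & mxrng P = V].

Definition signature_mx (d : nat) (K : 'M[C]_d) : Prop :=
  K \is hermsymmx /\ K *m K = 1%:M.

End MatrixNotions.

Section Realization.
Variables (C : numClosedFieldType) (d g : nat).
Variables (K : 'M[C]_d) (B : 'I_g -> 'M[C]_d) (c : 'cV[C]_d).

Definition adjfam (m : nat) (A : 'I_g -> 'M[C]_m) : 'I_g -> 'M[C]_m :=
  fun j => (A j) ^t*.

(* [inl j] is the letter evaluated at B_j K, [inr j] the one at B_j^* K. *)
Definition letter_mx (l : 'I_g + 'I_g) : 'M[C]_d :=
  match l with inl j => B j *m K | inr j => (B j) ^t* *m K end.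

Definition word_mx (w : seq ('I_g + 'I_g)) : 'M[C]_d :=
  \big[mulmx/1%:M]_(l <- w) letter_mx l.

Definition minimal : Prop :=
  forall v : 'cV[C]_d, exists ws : seq (seq ('I_g + 'I_g)),
    v \in <<[seq word_mx w *m c | w <- ws]>>%VS.

Section Evaluation.
Variables (n : nat) (X H : 'I_g -> 'M[C]_n).

Definition Lambda (A : 'I_g -> 'M[C]_d) (Y : 'I_g -> 'M[C]_n) : 'M[C]_(d * n) :=
  \sum_(j < g) A j *t Y j.

Definition pencil : 'M[C]_(d * n) :=
  K *t 1%:M - Lambda B X - Lambda (adjfam B) (adjfam X).

Definition in_domain : Prop := pencil \in unitmx.

Definition Delta : 'M[C]_(d * n) := invmx pencil.

(* Tensoring with a d x 1 column gives 1 * n columns instead of n. *)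
Definition Cmx : 'M[C]_(d * n, 1 * n) := c *t 1%:M.

Definition realization : 'M[C]_(1 * n) := Cmx ^t* *m Delta *m Cmx.

(* The part of the second-order expansion of [realization] at X that is linear
   in H and linear in H^*. *)
Definition complex_hessian : 'M[C]_(1 * n) :=
  let L := Lambda B H in
  let Ls := Lambda (adjfam B) (adjfam H) in
  Cmx ^t* *m Delta *m Ls *m Delta *m L *m Delta *m Cmx
  + Cmx ^t* *m Delta *m L *m Delta *m Ls *m Delta *m Cmx.

End Evaluation.

End Realization.

(* The radius is real, hence the base field R[i]. *)
Definition free_ball (R : realType) (g : nat) (eps : R) (n : nat)
    (X : 'I_g -> 'M[R[i]]_n) : Prop :=
  pdmx ((eps ^+ 2)%:C%:M - \sum_(j < g) (X j) ^t* *m X j).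

Definition plush_near0 (R : realType) (d g : nat) (K : 'M[R[i]]_d)
    (B : 'I_g -> 'M[R[i]]_d) (c : 'cV[R[i]]_d) : Prop :=
  exists eps : R,
    [/\ 0 < eps,
        forall (n : nat) (X : 'I_g -> 'M[R[i]]_n),
          free_ball eps X -> in_domain K B X
      & forall (n : nat) (X H : 'I_g -> 'M[R[i]]_n),
          free_ball eps X -> psdmx (complex_hessian K B c X H)].

(* Main.v *)
From HB Require Import structures.
Require Import Defs.
From mathcomp Require Import all_boot all_order all_algebra.
From mathcomp Require Import complex mxtens lra ring.
From mathcomp Require Import reals.
From mathcomp Require boolp.

(* If [a] lies in [rng B *t C^n] and [u = Delta(X) a], put [y = Lambda(X)^* u]
   and [w = a + Lambda(X) u].  Then [a^* u = w^* K w - y^* K y], where [w] is in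
   the range of [P *t 1] and [y] is small compared with [P K P w]; since
   [(P K P)^2 <= P K P], positivity of [P K P] makes the first half of the
   Hessian positive near 0, and [P_*] does the same for the second half.

   Conversely, consider the coordinates in C^n of Delta(X)(c *t xi).  For a
   pair (X, xi) whose coordinate matrix has maximal rank, bordering X by one
   row or column shows that the slices of that vector span a subspace
   containing K c and stable under the K B_j and K B_j^*, so by minimality
   they span C^d.  On X (+) 0, an H that maps the first block to the second then
   isolates one half of the Hessian and turns it into [v^* K v] with [v]
   arbitrary in rng B. *)

Set Implicit Arguments.
Unset Strict Implicit.
Unset Printing Implicit Defensive.

Import Order.TTheory GRing.Theory Num.Theory.
Local Open Scope ring_scope.
Local Open Scope sesquilinear_scope.
Local Open Scope complex_scope.

(** * A real inner product *)

Section Adjoint.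
Variable C : numClosedFieldType.

Lemma adjmx_mul m n p (A : 'M[C]_(m, n)) (B : 'M[C]_(n, p)) :
  (A *m B) ^t* = B ^t* *m A ^t*.
Proof. by rewrite trmx_mul map_mxM. Qed.

Lemma adjmxD m n (A B : 'M[C]_(m, n)) : (A + B) ^t* = A ^t* + B ^t*.
Proof. by rewrite linearD map_mxD. Qed.

Lemma adjmxB m n (A B : 'M[C]_(m, n)) : (A - B) ^t* = A ^t* - B ^t*.
Proof. by rewrite linearB map_mxB. Qed.

Lemma adjmxZ m n a (A : 'M[C]_(m, n)) : (a *: A) ^t* = a^* *: A ^t*.
Proof. by rewrite linearZ map_mxZ. Qed.

Lemma adjmx0 m n : (0 : 'M[C]_(m, n)) ^t* = 0.
Proof. by rewrite trmx0 map_mx0. Qed.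

Lemma adjmx1 n : (1%:M : 'M[C]_n) ^t* = 1%:M.
Proof. by rewrite trmx1 map_mx1. Qed.

Lemma adjmx_sum m n I (r : seq I) (F : I -> 'M[C]_(m, n)) :
  (\sum_(i <- r) F i) ^t* = \sum_(i <- r) (F i) ^t*.
Proof.
by elim/big_rec2: _ => [|i A B _ <-]; rewrite ?adjmx0 // adjmxD.
Qed.

Lemma adjmx_tens m n p q (A : 'M[C]_(m, n)) (B : 'M[C]_(p, q)) :
  (A *t B) ^t* = A ^t* *t B ^t*.
Proof. by rewrite trmx_tens map_mxT. Qed.

Lemma hermsymmxE n (A : 'M[C]_n) : (A \is hermsymmx) = (A == A ^t*).
Proof. by rewrite qualifE /= expr0 scale1r. Qed.

End Adjoint.

(** The real part makes the form symmetric and keeps every estimate in the ordered field [R], where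
    [lra] and [nra] apply. Quadratic forms of Hermitian matrices are real, so nothing is lost for
    them. *)
HB.lock Definition ip (R : rcfType) n (u v : 'cV[R[i]]_n) : R :=
  complex.Re ((u ^t* *m v) 0 0).

Section RealInnerProduct.
Variable R : rcfType.
Local Notation C := R[i].

Lemma ReD (x y : C) : complex.Re (x + y) = complex.Re x + complex.Re y.
Proof. by case: x; case: y. Qed.

Lemma ReN (x : C) : complex.Re (- x) = - complex.Re x.
Proof. by case: x. Qed.

Lemma Re_sum I (r : seq I) (F : I -> C) :
  complex.Re (\sum_(i <- r) F i) = \sum_(i <- r) complex.Re (F i).
Proof. by elim/big_rec2: _ => // i a b _ <-; rewrite ReD. Qed.

Lemma ipE n (u v : 'cV[C]_n) :
  ip u v = \sum_i complex.Re ((u i 0)^* * v i 0).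
Proof.
by rewrite ip.unlock mxE Re_sum; apply: eq_bigr => i _; rewrite !mxE.
Qed.

Lemma ip_sym n (u v : 'cV[C]_n) : ip u v = ip v u.
Proof.
rewrite !ipE; apply: eq_bigr => i _; case: (u i 0) => a b; case: (v i 0) => e f.
by rewrite /=; ring.
Qed.

Lemma ipDr n (u v w : 'cV[C]_n) : ip u (v + w) = ip u v + ip u w.
Proof. by rewrite ip.unlock mulmxDr mxE ReD. Qed.

Lemma ipNr n (u v : 'cV[C]_n) : ip u (- v) = - ip u v.
Proof. by rewrite ip.unlock mulmxN mxE ReN. Qed.

Lemma ipBr n (u v w : 'cV[C]_n) : ip u (v - w) = ip u v - ip u w.
Proof. by rewrite ipDr ipNr. Qed.

Lemma ipDl n (u v w : 'cV[C]_n) : ip (v + w) u = ip v u + ip w u.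
Proof. by rewrite ip_sym ipDr !(ip_sym u). Qed.

Lemma ipNl n (u v : 'cV[C]_n) : ip (- v) u = - ip v u.
Proof. by rewrite ip_sym ipNr ip_sym. Qed.

Lemma ipBl n (u v w : 'cV[C]_n) : ip (v - w) u = ip v u - ip w u.
Proof. by rewrite ipDl ipNl. Qed.

Lemma ip0r n (u : 'cV[C]_n) : ip u 0 = 0.
Proof. by rewrite ip.unlock mulmx0 mxE. Qed.

Lemma ip_sumr n I (r : seq I) (u : 'cV[C]_n) (F : I -> 'cV[C]_n) :
  ip u (\sum_(i <- r) F i) = \sum_(i <- r) ip u (F i).
Proof.
by elim/big_rec2: _ => [|i a b _ <-]; rewrite ?ip0r // ipDr.
Qed.

Lemma ipZZ n (a : C) (u v : 'cV[C]_n) :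
  ip (a *: u) (a *: v) = (complex.Re a ^+ 2 + complex.Im a ^+ 2) * ip u v.
Proof.
rewrite !ipE big_distrr; apply: eq_bigr => i _; rewrite !mxE.
case: a => x y; case: (u i 0) => a b; case: (v i 0) => e f.
by rewrite /=; ring.
Qed.

Lemma ip_mull n m (A : 'M[C]_(m, n)) u v : ip (A *m u) v = ip u (A ^t* *m v).
Proof. by rewrite ip.unlock adjmx_mul mulmxA. Qed.

Lemma ip_ge0 n (u : 'cV[C]_n) : 0 <= ip u u.
Proof.
rewrite ipE; apply: sumr_ge0 => i _; case: (u i 0) => a b /=.
by rewrite mulNr opprK addr_ge0 // -expr2 sqr_ge0.
Qed.

Lemma ip_eq0 n (u : 'cV[C]_n) : ip u u <= 0 -> u = 0.
Proof.
move=> u0; have {u0} : ip u u = 0 by apply: le_anti; rewrite u0 ip_ge0.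
rewrite ipE => /eqP; rewrite psumr_eq0 => [/allP u0|i _]; last first.
  case: (u i 0) => a b /=.
  by rewrite mulNr opprK addr_ge0 // -expr2 sqr_ge0.
apply/colP => i; rewrite mxE; move: (u0 i (mem_index_enum _)).
case: (u i 0) => a b /=; rewrite mulNr opprK -!expr2.
rewrite paddr_eq0 ?sqr_ge0 // !sqrf_eq0 => /andP[/eqP-> /eqP->].
by [].
Qed.

Lemma ip_realZr n (t : R) (u v : 'cV[C]_n) :
  ip u (t%:C *: v) = t * ip u v.
Proof.
rewrite !ipE big_distrr; apply: eq_bigr => i _; rewrite !mxE.
by case: (u i 0) => a b; case: (v i 0) => e f /=; ring.
Qed.

Lemma ip_addsqr n (u v : 'cV[C]_n) :
  ip (u + v) (u + v) <= 2 * ip u u + 2 * ip v v.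
Proof.
have := ip_ge0 (u - v).
by rewrite !ipDl !ipDr !ipNl !ipNr (ip_sym v u); lra.
Qed.

(** The cross term [2 t ip u v] is at most [t (ip u u + ip v v)]. The factor [1 + t] tends to 1 with
    [t], unlike the factor 2 of [ip_addsqr]; small perturbations depend on this. *)
Lemma ip_addsqr_wt n (t : R) (u v : 'cV[C]_n) : 0 < t ->
  ip (u + t%:C *: v) (u + t%:C *: v) <=
    (1 + t) * ip u u + (t + t ^+ 2) * ip v v.
Proof.
move=> t0; have := ip_ge0 (u - v).
rewrite !ipDl !ipDr !ipNl !ipNr (ip_sym v u) (ip_sym _ u) ip_realZr ipZZ /=.
nra.
Qed.

Lemma psdmx_ip n (A : 'M[C]_n) : psdmx A -> forall v, 0 <= ip v (A *m v).
Proof.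
by move=> [_ A0] v; have := A0 v; rewrite ip.unlock lecE -mulmxA => /andP[].
Qed.

(** For Hermitian [A] the number [v^* A v] equals its own conjugate, so its imaginary part vanishes
    and the inequality on real parts is one in the order of [C]. *)
Lemma ip_psdmx n (A : 'M[C]_n) : A \is hermsymmx ->
  (forall v, 0 <= ip v (A *m v)) -> psdmx A.
Proof.
move=> hA A0; split=> // v; rewrite lecE -mulmxA.
have := A0 v; rewrite ip.unlock => ->; rewrite andbT.
move: hA; rewrite hermsymmxE => /eqP hA.
have : (v ^t* *m (A *m v)) ^t* = v ^t* *m (A *m v).
  by rewrite !adjmx_mul trmxCK -hA mulmxA.
move/matrixP/(_ 0 0); rewrite [in X in X = _]mxE [in X in X = _]mxE.
case: ((_ *m _) 0 0) => a b /= [] h; apply/eqP; lra.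
Qed.

End RealInnerProduct.

(** * Tensor products acting on coordinate matrices *)

Section Vecm.
Variable F : comPzRingType.

(* The vector [\sum_k e_i *t f_k] of C^d *t C^n is the n x d matrix of its
   coordinates, so that [A *t X] acts by [W |-> X *m W *m A^T]. *)
Definition vecm d n (W : 'M[F]_(n, d)) : 'cV[F]_(d * n) :=
  \col_p W (mxtens_unindex p).2 (mxtens_unindex p).1.

Definition unvecm d n (v : 'cV[F]_(d * n)) : 'M[F]_(n, d) :=
  \matrix_(k, i) v (mxtens_index (i, k)) 0.

Lemma vecmK d n : cancel (@vecm d n) (@unvecm d n).
Proof. by move=> W; apply/matrixP => k i; rewrite !mxE mxtens_indexK. Qed.

Lemma unvecmK d n : cancel (@unvecm d n) (@vecm d n).
Proof.
move=> v; apply/colP => p; rewrite !mxE.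
by rewrite -surjective_pairing mxtens_unindexK.
Qed.

Lemma vecmD d n (V W : 'M[F]_(n, d)) : vecm (V + W) = vecm V + vecm W.
Proof. by apply/colP => p; rewrite !mxE. Qed.

Lemma vecmN d n (W : 'M[F]_(n, d)) : vecm (- W) = - vecm W.
Proof. by apply/colP => p; rewrite !mxE. Qed.

Lemma vecmZ d n a (W : 'M[F]_(n, d)) : vecm (a *: W) = a *: vecm W.
Proof. by apply/colP => p; rewrite !mxE. Qed.

Lemma vecm0 d n : vecm (0 : 'M[F]_(n, d)) = 0.
Proof. by apply/colP => p; rewrite !mxE. Qed.

Lemma vecm_sum d n I (r : seq I) (G : I -> 'M[F]_(n, d)) :
  vecm (\sum_(i <- r) G i) = \sum_(i <- r) vecm (G i).
Proof.
by elim/big_rec2: _ => [|i A B _ <-]; rewrite ?vecm0 // vecmD.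
Qed.

Lemma sum_mxtens d n (G : 'I_(d * n) -> F) :
  \sum_p G p = \sum_k \sum_i G (mxtens_index (i, k)).
Proof.
rewrite exchange_big pair_bigA (reindex (@mxtens_index d n)) /=; last first.
  exists (@mxtens_unindex d n) => p _; first exact: mxtens_indexK.
  exact: mxtens_unindexK.
by apply: eq_bigr => -[].
Qed.

Lemma tens_vecm d d' n n' (A : 'M[F]_(d', d)) (X : 'M[F]_(n', n)) W :
  (A *t X) *m vecm W = vecm (X *m W *m A^T).
Proof.
apply/colP => p; rewrite -(mxtens_unindexK p); case: (mxtens_unindex p) => i k.
rewrite !mxE mxtens_indexK sum_mxtens exchange_big /=.
apply: eq_bigr => j _; rewrite !mxE big_distrl /=; apply: eq_bigr => l _.
by rewrite tensmxE !mxE mxtens_indexK -mulrA mulrC.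
Qed.

End Vecm.

(** * Norm bounds for matrices and their tensor products *)

Section TensorForms.
Variable R : rcfType.
Local Notation C := R[i].

(** [A *t 1] acts on each row of the coordinate matrix separately, and [1 *t X] on each column;
    hence this decomposition and the next one. *)
Lemma ip_vecm_row d n (V W : 'M[C]_(n, d)) :
  ip (vecm V) (vecm W) = \sum_k ip (row k V)^T (row k W)^T.
Proof.
rewrite ipE sum_mxtens; apply: eq_bigr => k _; rewrite ipE.
by apply: eq_bigr => i _; rewrite !mxE mxtens_indexK.
Qed.

Lemma ip_vecm_col d n (V W : 'M[C]_(n, d)) :
  ip (vecm V) (vecm W) = \sum_i ip (col i V) (col i W).
Proof.
rewrite ipE sum_mxtens exchange_big; apply: eq_bigr => i _; rewrite ipE.
by apply: eq_bigr => k _; rewrite !mxE mxtens_indexK.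
Qed.

Lemma ip_tensmx1_ge0 d n (T : 'M[C]_d) :
  (forall v, 0 <= ip v (T *m v)) ->
  forall v : 'cV_(d * n), 0 <= ip v ((T *t 1%:M) *m v).
Proof.
move=> T0 v; rewrite -(unvecmK v) tens_vecm mul1mx ip_vecm_row.
by apply: sumr_ge0 => k _; rewrite row_mul trmx_mul trmxK T0.
Qed.

(** [b] bounds the square of the operator norm, which avoids square roots: the value [1 / 16] used
    below means norm at most [1 / 4]. *)
Definition opbounded m n (b : R) (A : 'M[C]_(m, n)) :=
  forall v, ip (A *m v) (A *m v) <= b * ip v v.

Lemma opbounded_tens1 d n b (A : 'M[C]_d) :
  opbounded b A -> opbounded b (A *t (1%:M : 'M_n)).
Proof.
move=> Ab v; rewrite -(unvecmK v) tens_vecm mul1mx !ip_vecm_row.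
rewrite big_distrr; apply: ler_sum => k _.
by rewrite row_mul trmx_mul trmxK Ab.
Qed.

Lemma opbounded_1tens d n b (X : 'M[C]_n) :
  opbounded b X -> opbounded b ((1%:M : 'M_d) *t X).
Proof.
move=> Xb v; rewrite -(unvecmK v) tens_vecm trmx1 mulmx1 !ip_vecm_col.
by rewrite big_distrr; apply: ler_sum => i _; rewrite !colE -mulmxA Xb.
Qed.

Lemma opboundedM m n p a b (A : 'M[C]_(m, n)) (B : 'M_(n, p)) : 0 <= a ->
  opbounded a A -> opbounded b B -> opbounded (a * b) (A *m B).
Proof.
move=> a0 Aa Bb v; rewrite -mulmxA; apply: le_trans (Aa _) _.
by rewrite -mulrA ler_wpM2l.
Qed.

Lemma opbounded_tens d n a b (A : 'M[C]_d) (X : 'M_n) : 0 <= a ->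
  opbounded a A -> opbounded b X -> opbounded (a * b) (A *t X).
Proof.
move=> a0 Aa Xb; rewrite -(mulmx1 A) -(mul1mx X) -tensmx_mul.
by apply: opboundedM => //; [exact: opbounded_tens1|exact: opbounded_1tens].
Qed.

(** With [y = A^* v], expanding [0 <= |b v - A y|^2] and using [|A y|^2 <= b |y|^2] gives
    [b |y|^2 <= b^2 |v|^2]. *)
Lemma opbounded_adj m n b (A : 'M[C]_(m, n)) : 0 < b ->
  opbounded b A -> opbounded b (A ^t*).
Proof.
move=> b0 Ab v; set y := A ^t* *m v.
have := Ab y; have := ip_ge0 (b%:C *: v - A *m y).
rewrite ipBl !ipBr ipZZ (ip_sym _ (A *m y)) ip_realZr ip_mull -/y /=.
rewrite expr0n addr0.
move=> h1 h2; have : b * ip y y <= b * (b * ip v v) by lra.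
by rewrite ler_pM2l.
Qed.

(** Cauchy-Schwarz, from Lagrange's identity: the gap between the two sides is half the sum of all
    [|u_i - u_j|^2]. *)
Lemma ip_sumsqr n m (u : 'I_m -> 'cV[C]_n) :
  ip (\sum_i u i) (\sum_i u i) <= m%:R * \sum_i ip (u i) (u i).
Proof.
have E : \sum_i \sum_j ip (u i - u j) (u i - u j) =
  2 * (m%:R * \sum_i ip (u i) (u i) - ip (\sum_i u i) (\sum_i u i)).
  have -> : ip (\sum_i u i) (\sum_i u i) = \sum_i \sum_j ip (u i) (u j).
    rewrite ip_sumr; apply: eq_bigr => i _.
    by rewrite ip_sym ip_sumr.
  transitivity (\sum_i \sum_j (ip (u i) (u i) + ip (u j) (u j) -
                               2 * ip (u i) (u j))).
    apply: eq_bigr => i _; apply: eq_bigr => j _.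
    by rewrite ipBl !ipBr (ip_sym (u j) (u i)); ring.
  under eq_bigr do rewrite sumrB big_split /= sumr_const card_ord -big_distrr.
  rewrite sumrB big_split /= sumr_const card_ord -big_distrr /= sumrMnl.
  by rewrite -mulr_natl; ring.
have : 0 <= \sum_i \sum_j ip (u i - u j) (u i - u j).
  by do 2![apply: sumr_ge0 => ? _]; exact: ip_ge0.
by rewrite E; lra.
Qed.

Lemma opbounded_sum m n k b (A : 'I_k -> 'M[C]_(m, n)) :
  (forall i, opbounded (b i) (A i)) ->
  opbounded (k%:R * \sum_i b i) (\sum_i A i).
Proof.
move=> Ab v; rewrite mulmx_suml; apply: le_trans (ip_sumsqr _) _.
rewrite -mulrA ler_wpM2l ?ler0n // big_distrl.
by apply: ler_sum => i _; exact: Ab.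
Qed.

Lemma opbounded_ex m n (A : 'M[C]_(m, n)) : exists2 b, 0 <= b & opbounded b A.
Proof.
pose s j := ip (col j A) (col j A).
have s0 j : 0 <= s j by exact: ip_ge0.
exists (n%:R * \sum_j s j); first by rewrite mulr_ge0 ?ler0n ?sumr_ge0.
move=> v; have -> : A *m v = \sum_j v j 0 *: col j A.
  apply/colP => i; rewrite summxE !mxE; apply: eq_bigr => j _.
  by rewrite !mxE mulrC.
apply: le_trans (ip_sumsqr _) _; rewrite -mulrA ler_wpM2l ?ler0n //.
rewrite big_distrl; apply: ler_sum => j _; rewrite ipZZ mulrC.
rewrite ler_wpM2l //; first exact: s0.
rewrite ipE (bigD1 j) //=; case: (v j 0) => x y /=.
rewrite mulNr opprK -!expr2 lerDl sumr_ge0 // => i _.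
by case: (v i 0) => p q /=; rewrite mulNr opprK -!expr2 addr_ge0 ?sqr_ge0.
Qed.

Lemma opbounded_le m n a b (A : 'M[C]_(m, n)) :
  a <= b -> opbounded a A -> opbounded b A.
Proof.
by move=> ab Aa v; apply: le_trans (Aa v) _; rewrite ler_wpM2r ?ip_ge0.
Qed.

End TensorForms.

(** * Small perturbations of a signature matrix *)

Section SignatureForms.
Variable R : rcfType.
Local Notation C := R[i].
Variable N : nat.
Variables (K P L : 'M[C]_N).
Hypotheses (hK : K ^t* = K) (K2 : K *m K = 1%:M).
Hypothesis Lb : opbounded (1 / 16) L.
Hypothesis Lsb : opbounded (1 / 16) (L ^t*).

Lemma signature_isometry (u : 'cV[C]_N) : ip (K *m u) (K *m u) = ip u u.
Proof. by rewrite ip_mull hK mulmxA K2 mul1mx. Qed.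

Lemma pencil_inj (u : 'cV_N) : (K - L - L ^t*) *m u = 0 -> u = 0.
Proof.
rewrite !mulmxBl -addrA -opprD => /eqP; rewrite subr_eq0 => /eqP Ku.
have := signature_isometry u; rewrite Ku => E; apply: ip_eq0.
have := ip_addsqr (L *m u) (L ^t* *m u); have := Lb u; have := Lsb u.
by rewrite E; have := ip_ge0 u; lra.
Qed.

(* With [y = L^* u] and [w = a + L u] one has [u = K (w + y)], hence
   [a^* u = w^* K w - y^* K y]; and [y] is controlled by [P K P w], whose
   squared norm is at most [w^* K w] since [0 <= P K P <= 1]. *)
Lemma resolvent_ge0 (u a : 'cV_N) :
  P ^t* = P -> P *m P = P -> (forall v, 0 <= ip v (P *m K *m P *m v)) ->
  P *m L = L -> P *m a = a -> (K - L - L ^t*) *m u = a -> 0 <= ip a u.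
Proof.
move=> hP P2 PKP PL Pa Hu.
have [y yD] : {y | y = L ^t* *m u} by eexists.
have [w wD] : {w | w = a + L *m u} by eexists.
have Ku : K *m u = w + y.
  by rewrite wD yD -Hu !mulmxBl -addrA [X in _ + X]addrC addrA !subrK.
have uE : u = K *m w + K *m y by rewrite -mulmxDr -Ku mulmxA K2 mul1mx.
have Pw : P *m w = w by rewrite wD mulmxDr Pa mulmxA PL.
have LsP : L ^t* *m P = L ^t* by rewrite -[in RHS]PL adjmx_mul hP.
have [z zD] : {z | z = P *m (K *m w)} by eexists.
have Pz : P *m z = z by rewrite zD mulmxA P2.
(* Since [L^* = L^* P], only the compression [z] of [K w] contributes to [y]. *)
have yE : y = L ^t* *m z + L ^t* *m (K *m y).
  by rewrite zD (mulmxA (L ^t*) P) LsP -mulmxDr -uE.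
have Pip v1 v2 : ip v1 (P *m v2) = ip (P *m v1) v2 by rewrite ip_mull hP.
have Kip v1 v2 : ip v1 (K *m v2) = ip (K *m v1) v2 by rewrite ip_mull hK.
have le_K v : ip v (K *m v) <= ip v v.
  have := ip_ge0 (v - K *m v).
  by rewrite ipBl !ipBr signature_isometry (ip_sym (K *m v)); lra.
(* Positivity of [P K P] is tested at [w - z]: the form equals [w^* K w - 2 |z|^2 + z^* K z], and
   [z^* K z <= |z|^2]. *)
have zz : ip z z <= ip w (K *m w).
  have := PKP (w - z); rewrite -!mulmxA Pip mulmxBr Pw Pz mulmxBr ipBl !ipBr.
  have wKz : ip w (K *m z) = ip z z by rewrite Kip -{1}Pz Pip -zD.
  by rewrite (Kip z w) (ip_sym _ w) wKz; have := le_K z; lra.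
have au : ip a u = ip w (K *m w) - ip y (K *m y).
  have -> : a = w - L *m u by rewrite wD addrK.
  have wu : ip w u = ip w (K *m w) + ip w (K *m y) by rewrite -ipDr -uE.
  have uy : ip u y = ip w (K *m y) + ip y (K *m y).
    by rewrite ip_sym [in LHS]uE ipDr [ip y (K *m w)]Kip (ip_sym _ w).
  by rewrite ipBl ip_mull -yD wu uy; lra.
(* [|y|^2 <= (|z|^2 + |y|^2) / 8], and the second term is absorbed on the left. *)
have yz : ip y y <= ip z z.
  have := ip_addsqr (L ^t* *m z) (L ^t* *m (K *m y)); rewrite -yE.
  have := Lsb z; have := Lsb (K *m y); rewrite signature_isometry.
  by have := ip_ge0 z; lra.
by rewrite au; have := le_K y; lra.
Qed.

End SignatureForms.

(** * Sufficiency *)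

Section PencilSymmetry.
Variables (C : numClosedFieldType) (d g n : nat).
Implicit Types (K : 'M[C]_d) (B : 'I_g -> 'M[C]_d) (X : 'I_g -> 'M[C]_n).

Lemma adjmx_Lambda B X :
  (Lambda B X) ^t* = Lambda (adjfam B) (adjfam X).
Proof. by rewrite adjmx_sum; apply: eq_bigr => j _; rewrite adjmx_tens. Qed.

Lemma Lambda_adjK B X :
  Lambda (adjfam (adjfam B)) (adjfam (adjfam X)) = Lambda B X.
Proof. by apply: eq_bigr => j _; rewrite /adjfam !trmxCK. Qed.

Lemma pencil_adj K B X : pencil K (adjfam B) (adjfam X) = pencil K B X.
Proof. by rewrite /pencil Lambda_adjK addrAC. Qed.

(** Passing to adjoints swaps the two halves of the Hessian, so a result on the half with [B], once
    applied to [adjfam B], covers the other. *)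
Lemma complex_hessian_adj K B (c : 'cV[C]_d) X H :
  complex_hessian K (adjfam B) c (adjfam X) (adjfam H) =
  complex_hessian K B c X H.
Proof. by rewrite /complex_hessian /Delta pencil_adj Lambda_adjK addrC. Qed.

Lemma adjmx_pencil K B X : K ^t* = K -> (pencil K B X) ^t* = pencil K B X.
Proof.
move=> hK; rewrite !adjmxB !adjmx_Lambda Lambda_adjK adjmx_tens hK adjmx1.
by rewrite addrAC.
Qed.

Lemma adjmx_Delta K B X : K ^t* = K -> (Delta K B X) ^t* = Delta K B X.
Proof. by move=> hK; rewrite trmx_inv map_invmx adjmx_pencil. Qed.

Lemma complex_hessian_herm K B (c : 'cV[C]_d) X H : K ^t* = K ->
  complex_hessian K B c X H \is hermsymmx.
Proof.
move=> hK; rewrite hermsymmxE /complex_hessian -!adjmx_Lambda adjmxD.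
by rewrite !adjmx_mul !trmxCK adjmx_Delta // !mulmxA.
Qed.

End PencilSymmetry.

(** * The free ball and bounds uniform in the matrix size *)

Section FreeBall.
Variable R : realType.
Local Notation C := R[i].

Lemma pdmx_ip n (A : 'M[C]_n) : A \is hermsymmx ->
  pdmx A <-> forall v, v != 0 -> 0 < ip v (A *m v).
Proof.
move=> hA; split=> [[_ A0] v v0|A0].
  by have := A0 v v0; rewrite ip.unlock ltcE -mulmxA => /andP[].
have [_ psdA] : psdmx A.
  apply: ip_psdmx => // v; have [->|v0] := eqVneq v 0; last exact/ltW/A0.
  by rewrite mulmx0 ip0r.
split=> // v v0; have := psdA v; rewrite lecE ltcE => /andP[-> _] /=.
by have := A0 v v0; rewrite ip.unlock -mulmxA.
Qed.

Lemma free_ballP g (eps : R) n (X : 'I_g -> 'M[C]_n) :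
  free_ball eps X <-> forall v, v != 0 ->
    \sum_j ip (X j *m v) (X j *m v) < eps ^+ 2 * ip v v.
Proof.
have ipE v : ip v (((eps ^+ 2)%:C%:M - \sum_j X j ^t* *m X j) *m v) =
    eps ^+ 2 * ip v v - \sum_j ip (X j *m v) (X j *m v).
  rewrite mulmxBl ipBr mul_scalar_mx ip_realZr mulmx_suml ip_sumr.
  by congr (_ - _); apply: eq_bigr => j _; rewrite ip_mull mulmxA.
rewrite /free_ball pdmx_ip.
  by split=> h v /h; rewrite ipE subr_gt0.
rewrite hermsymmxE adjmxB adjmx_sum tr_scalar_mx map_scalar_mx.
apply/eqP; congr (_ - _).
  by congr (_%:M); exact/esym/conjc_real.
by apply: eq_bigr => j _; rewrite adjmx_mul trmxCK.
Qed.

Lemma free_ball_opbounded g (eps : R) n (X : 'I_g -> 'M[C]_n) j :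
  free_ball eps X -> opbounded (eps ^+ 2) (X j).
Proof.
move=> /free_ballP XB v; have [->|/XB/ltW] := eqVneq v 0.
  by rewrite mulmx0 !ip0r mulr0.
apply: le_trans; rewrite (bigD1 j) //= lerDl sumr_ge0 // => i _.
exact: ip_ge0.
Qed.

End FreeBall.

Lemma tens11mx (F : comPzRingType) m n :
  (1%:M : 'M[F]_m) *t (1%:M : 'M[F]_n) = 1%:M.
Proof.
apply/matrixP => p q; case: (mxtens_indexP p) => i k.
case: (mxtens_indexP q) => j l; rewrite tensmxE !mxE.
by rewrite (can_eq (@mxtens_indexK m n)) xpair_eqE -natrM mulnb.
Qed.

(** The constant depends on [B] alone and not on [n]; this is what lets a single radius serve all
    matrix sizes. *)
Lemma opbounded_Lambda (R : rcfType) (d g : nat) (B : 'I_g -> 'M[R[i]]_d) :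
  exists2 b, 0 <= b & forall n r (X : 'I_g -> 'M[R[i]]_n),
    (forall j, opbounded r (X j)) -> opbounded (b * r) (Lambda B X).
Proof.
have [b b0 Bb] : exists2 b : 'I_g -> R, forall j, 0 <= b j &
    forall j, opbounded (b j) (B j).
  apply: (@fin_all_exists2 _ _ (fun _ b => 0 <= b)
                           (fun j b => opbounded b (B j))).
  by move=> j; exact: opbounded_ex.
exists (g%:R * \sum_j b j); first by rewrite mulr_ge0 ?sumr_ge0.
move=> n r X Xr; rewrite -mulrA big_distrl; apply: opbounded_sum => j.
exact: opbounded_tens.
Qed.

Lemma ip_sandwich (R : rcfType) p N (Z : 'M[R[i]]_(N, p)) (D M : 'M_N) v :
  D ^t* = D ->
  ip v (Z ^t* *m D *m M ^t* *m D *m M *m D *m Z *m v) =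
  ip (M *m (D *m (Z *m v))) (D *m (M *m (D *m (Z *m v)))).
Proof. by move=> hD; rewrite -!mulmxA !ip_mull hD. Qed.

(** As [Delta] is Hermitian, each half of the Hessian takes the form [a^* Delta a], with [a] the
    image of the same vector [u] under [Lambda B H] or its adjoint. [resolvent_ge0] concerns exactly
    such expressions. *)
Lemma ip_hessian (R : rcfType) d g n (K : 'M[R[i]]_d) B c
    (X H : 'I_g -> 'M_n) z : K ^t* = K ->
  let D := Delta K B X in let u := D *m (Cmx c n *m z) in
  ip z (complex_hessian K B c X H *m z) =
  ip (Lambda B H *m u) (D *m (Lambda B H *m u)) +
  ip (Lambda (adjfam B) (adjfam H) *m u)
     (D *m (Lambda (adjfam B) (adjfam H) *m u)).
Proof.
move=> hK D u; have hD := adjmx_Delta B X hK.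
rewrite /complex_hessian mulmxDl ipDr -(adjmx_Lambda B H).
rewrite -(ip_sandwich (Cmx c n) (Lambda B H) z hD).
rewrite -(ip_sandwich (Cmx c n) (Lambda B H ^t*) z hD).
by rewrite trmxCK.
Qed.

Lemma unitmx_inj (F : fieldType) n (A : 'M[F]_n) :
  (forall u : 'cV_n, A *m u = 0 -> u = 0) -> A \in unitmx.
Proof.
move=> A0; rewrite -unitmx_tr -row_free_unit; apply: inj_row_free => v vA.
apply: (can_inj (@trmxK _ _ _)); rewrite trmx0; apply: A0.
by rewrite -[A]trmxK -trmx_mul vA trmx0.
Qed.

Section Sufficiency.
Variables (R : realType) (d g : nat).
Local Notation C := R[i].
Variable (K : 'M[C]_d).
Hypotheses (hK : K ^t* = K) (K2 : K *m K = 1%:M).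

Section Resolvent.
Variables (n : nat) (B : 'I_g -> 'M[C]_d) (X : 'I_g -> 'M[C]_n).
Hypothesis Lb : opbounded (1 / 16) (Lambda B X).

Let Ln := Lambda B X.
Let Kn := K *t (1%:M : 'M[C]_n).

Lemma tens_signature_adj : Kn ^t* = Kn.
Proof. by rewrite adjmx_tens hK adjmx1. Qed.

Lemma tens_signature_sqr : Kn *m Kn = 1%:M.
Proof. by rewrite tensmx_mul K2 mul1mx tens11mx. Qed.

Lemma Lambda_adj_opbounded : opbounded (1 / 16) (Ln ^t*).
Proof. by apply: opbounded_adj => //; lra. Qed.

Lemma pencilE : pencil K B X = Kn - Ln - Ln ^t*.
Proof. by rewrite adjmx_Lambda. Qed.

Lemma pencil_unit : in_domain K B X.
Proof.
apply: unitmx_inj => u; rewrite pencilE; apply: pencil_inj => //.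
- exact: tens_signature_adj.
- exact: tens_signature_sqr.
- exact: Lambda_adj_opbounded.
Qed.

Lemma Delta_ge0 (P : 'M[C]_d) (H : 'I_g -> 'M[C]_n) z :
  P ^t* = P -> P *m P = P -> (forall v, 0 <= ip v (P *m K *m P *m v)) ->
  (forall j, P *m B j = B j) ->
  0 <= ip (Lambda B H *m z) (Delta K B X *m (Lambda B H *m z)).
Proof.
move=> hP P2 PKP PB.
have PL Y : (P *t (1%:M : 'M[C]_n)) *m Lambda B Y = Lambda B Y.
  rewrite mulmx_sumr; apply: eq_bigr => j _.
  by rewrite tensmx_mul PB mul1mx.
apply: (@resolvent_ge0 _ _ Kn (P *t 1%:M) Ln) => //.
- exact: tens_signature_adj.
- exact: tens_signature_sqr.
- exact: Lambda_adj_opbounded.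
- by rewrite adjmx_tens hP adjmx1.
- by rewrite tensmx_mul P2 mul1mx.
- by move=> v; rewrite !tensmx_mul !mulmx1; apply: ip_tensmx1_ge0.
- exact: PL.
- by rewrite mulmxA PL.
- rewrite -pencilE (mulmxA (pencil K B X)) mulmxV ?mul1mx //.
  exact: pencil_unit.
Qed.

End Resolvent.

Lemma plush_of_compressions (B : 'I_g -> 'M[C]_d) (c : 'cV[C]_d)
    (P Ps : 'M[C]_d) :
  P ^t* = P -> P *m P = P -> (forall j, P *m B j = B j) ->
  (forall v, 0 <= ip v (P *m K *m P *m v)) ->
  Ps ^t* = Ps -> Ps *m Ps = Ps -> (forall j, Ps *m (B j) ^t* = (B j) ^t*) ->
  (forall v, 0 <= ip v (Ps *m K *m Ps *m v)) ->
  plush_near0 K B c.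
Proof.
move=> hP P2 PB PKP hPs Ps2 PsB PsKPs.
have [b b0 Lb] := opbounded_Lambda B.
have e0 : 0 < (4 * (b + 1))^-1 by rewrite invr_gt0; lra.
(* The squared norm of [Lambda B X] is then at most [b / (16 (b + 1)^2) <= 1 / 16]; the summand 1
   keeps the denominator positive when [b = 0]. *)
exists (4 * (b + 1))^-1; set e := (4 * (b + 1))^-1 in e0 *.
have e1 : e * (4 * (b + 1)) = 1 by rewrite mulVf //; apply/eqP; lra.
have {}Lb n (X : 'I_g -> 'M[C]_n) :
    free_ball e X -> opbounded (1 / 16) (Lambda B X).
  move=> XB; apply: opbounded_le (Lb n (e ^+ 2) X _); last first.
    by move=> j; exact: free_ball_opbounded.
  have e2 : e ^+ 2 * (16 * (b ^+ 2 + 2 * b + 1)) = 1.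
    have : (e * (4 * (b + 1))) ^+ 2 = 1 by rewrite e1 expr1n.
    lra.
  have := sqr_ge0 e; have := sqr_ge0 b; nra.
split=> // [n X /Lb|n X H /Lb XB]; first exact: pencil_unit.
apply: ip_psdmx; first exact: complex_hessian_herm.
move=> v; rewrite ip_hessian // addr_ge0 //.
  exact: (Delta_ge0 XB (P := P)).
(* The second half is the first half of the adjoint data, which have the same pencil. *)
rewrite [Delta K B X](_ : _ = Delta K (adjfam B) (adjfam X)); last first.
  by rewrite /Delta pencil_adj.
apply: (@Delta_ge0 n (adjfam B) (adjfam X) _ Ps (adjfam H) _
                   hPs Ps2 PsKPs PsB).
by rewrite -adjmx_Lambda; exact: Lambda_adj_opbounded.
Qed.

End Sufficiency.

(** * Admissible tuples *)

Lemma adjfamK (C : numClosedFieldType) g n : involutive (@adjfam C g n).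
Proof. by move=> X; apply: boolp.funext => j; rewrite /adjfam trmxCK. Qed.

Lemma adjmx_block (C : numClosedFieldType) m1 m2 n1 n2 (A : 'M[C]_(m1, n1))
    (B : 'M_(m1, n2)) (D : 'M_(m2, n1)) (E : 'M_(m2, n2)) :
  (block_mx A B D E) ^t* = block_mx (A ^t*) (D ^t*) (B ^t*) (E ^t*).
Proof. by rewrite tr_block_mx map_block_mx. Qed.

(** * Recovering the constant term of a matrix resolvent *)

Section ResolventPolynomial.
Variables (F : fieldType) (d n : nat).

(* [G *m \adj (1 - x E)] is polynomial in x; its entries modulo the row space
   of W vanish at all [tau k], hence identically, hence at [x = 0]. *)
Lemma resolvent_submx (G : 'rV[F]_d) (E : 'M_d) (W : 'M_(n, d))
    (tau : nat -> F) : injective tau ->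
  (forall k, exists2 s : 'rV_d, (s <= W)%MS & s = G + tau k *: (s *m E)) ->
  (G <= W)%MS.
Proof.
move=> tauI sol; rewrite submxE.
pose Q : 'rV[{poly F}]_d := map_mx polyC G *m
  \adj (1%:M - 'X *: map_mx polyC E) *m map_mx polyC (cokermx W).
have Qe x : map_mx (horner_eval x) Q =
    G *m \adj (1%:M - x *: E) *m cokermx W.
  have polyCK m p (A : 'M[F]_(m, p)) :
      map_mx (horner_eval x) (map_mx polyC A) = A.
    by apply/matrixP => i j; rewrite !mxE /horner_eval hornerC.
  rewrite /Q; move: (cokermx W) => V.
  rewrite !map_mxM map_mx_adj map_mxB map_mx1 map_mxZ !polyCK.
  by rewrite /= /horner_eval hornerX.
have Q0 j : Q 0 j = 0.
  pose rs := [seq tau k | k <- iota 0 (size (Q 0 j))].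
  apply: (@roots_geq_poly_eq0 _ _ rs); last by rewrite size_map size_iota.
    apply/allP => _ /mapP[k _ ->]; have [s sW sE] := sol k.
    have GE : G = s *m (1%:M - tau k *: E).
      by rewrite mulmxBr mulmx1 -scalemxAr {1}sE addrK.
    (* [G *m \adj (1 - tau k E)] collapses to [\det (1 - tau k E)] times [s], which the cokernel of
       [W] kills even where that determinant is zero. *)
    have := Qe (tau k); rewrite GE -(mulmxA s) mul_mx_adj mul_mx_scalar.
    rewrite -scalemxAl (eqP (_ : s *m cokermx W == 0)) -?submxE // scaler0.
    by move/matrixP/(_ 0 j); rewrite !mxE => /eqP.
  by rewrite map_inj_uniq ?iota_uniq.
have {}Q0 : Q = 0 by apply/rowP => j; rewrite Q0 mxE.
have := Qe 0; rewrite Q0 map_mx0 scale0r subr0.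
by rewrite -[\adj 1%:M]mul1mx mul_mx_adj det1 mulmx1 => /esym/eqP.
Qed.

End ResolventPolynomial.

(** This is [Lambda B X] read on coordinate matrices. The [X j] may be rectangular, so that it
    applies to the off-diagonal blocks of a bordered tuple. *)
HB.lock Definition slam (F : comPzRingType) g d (B : 'I_g -> 'M[F]_d) m n
    (X : 'I_g -> 'M[F]_(m, n)) (W : 'M[F]_(n, d)) : 'M[F]_(m, d) :=
  \sum_j X j *m W *m (B j)^T.

Section BlockSums.
Variables (F : comPzRingType) (g d : nat).
Variable B : 'I_g -> 'M[F]_d.
Local Notation slam := (slam B).

Lemma slam0l m n (W : 'M_(n, d)) : slam (fun=> 0 : 'M_(m, n)) W = 0.
Proof. by rewrite slam.unlock big1 // => j _; rewrite !mul0mx. Qed.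

Lemma slam0r m n (X : 'I_g -> 'M_(m, n)) : slam X 0 = 0.
Proof. by rewrite slam.unlock big1 // => j _; rewrite mulmx0 mul0mx. Qed.

Lemma slam_delta m n j (M : 'M_(m, n)) W :
  slam (fun k => (k == j)%:R *: M) W = M *m W *m (B j)^T.
Proof.
rewrite slam.unlock (bigD1 j) //= eqxx scale1r big1 ?addr0 // => k /negPf ->.
by rewrite scale0r !mul0mx.
Qed.

Lemma slam_block m1 m2 n1 n2 (X11 : 'I_g -> 'M_(m1, n1))
    (X12 : 'I_g -> 'M_(m1, n2)) (X21 : 'I_g -> 'M_(m2, n1))
    (X22 : 'I_g -> 'M_(m2, n2)) (U : 'M_(n1, d)) (S : 'M_(n2, d)) :
  slam (fun j => block_mx (X11 j) (X12 j) (X21 j) (X22 j)) (col_mx U S) =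
  col_mx (slam X11 U + slam X12 S) (slam X21 U + slam X22 S).
Proof.
rewrite slam.unlock -!big_split /=.
elim/big_rec3: _ => [|j Y Z V _ ->]; first by rewrite col_mx0.
by rewrite mul_block_col mul_col_mx add_col_mx !mulmxDl.
Qed.

End BlockSums.

Section Admissible.
Variable R : realType.
Local Notation C := R[i].
Variables (g : nat) (eps : R).

(* A ball stable under adjoints and, thanks to the margin [eps ^+ 2 - r],
   under small perturbations. *)
Definition adm n (X : 'I_g -> 'M[C]_n) : Prop :=
  exists2 r, 0 <= r < eps ^+ 2 & forall v : 'cV_n,
    \sum_j (ip (X j *m v) (X j *m v) + ip (X j ^t* *m v) (X j ^t* *m v))
      <= r * ip v v.

Lemma adm_free_ball n (X : 'I_g -> 'M[C]_n) : adm X -> free_ball eps X.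
Proof.
move=> [r /andP[r0 re] Xr]; apply/free_ballP => v v0.
have vv : 0 < ip v v.
  by rewrite ltNge; apply/negP => /ip_eq0/eqP; rewrite (negPf v0).
have := Xr v; rewrite big_split /=.
have : 0 <= \sum_j ip (X j ^t* *m v) (X j ^t* *m v).
  by apply: sumr_ge0 => j _; exact: ip_ge0.
nra.
Qed.

Lemma adm_adj n (X : 'I_g -> 'M[C]_n) : adm X -> adm (adjfam X).
Proof.
move=> [r re Xr]; exists r => [//|v]; apply: le_trans (Xr v).
rewrite le_eqVlt; apply/orP; left; apply/eqP; apply: eq_bigr => j _.
by rewrite /adjfam trmxCK addrC.
Qed.

Lemma adm0 n : 0 < eps -> adm (fun=> 0 : 'M_n).
Proof.
move=> e0; exists 0 => [|v]; first by rewrite lexx exprn_gt0.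
by rewrite big1 ?mul0r // => j _; rewrite adjmx0 !mul0mx !ip0r addr0.
Qed.

Lemma ip_col_mx n1 n2 (a b : 'cV[C]_n1) (a' b' : 'cV_n2) :
  ip (col_mx a a') (col_mx b b') = ip a b + ip a' b'.
Proof.
rewrite !ipE big_split_ord /=; congr (_ + _); apply: eq_bigr => i _.
  by rewrite !col_mxEu.
by rewrite !col_mxEd.
Qed.

Lemma adm_dsum n1 n2 (X : 'I_g -> 'M[C]_n1) (Y : 'I_g -> 'M[C]_n2) :
  adm X -> adm Y -> adm (fun j => block_mx (X j) 0 0 (Y j)).
Proof.
move=> [r /andP[r0 re] Xr] [s /andP[s0 se] Ys].
exists (Num.max r s); first by rewrite le_max r0 /= gt_max re se.
move=> v; rewrite -(vsubmxK v) ip_col_mx mulrDr.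
set a := usubmx v; set b := dsubmx v.
apply: le_trans (_ : r * ip a a + s * ip b b <= _); last first.
  by rewrite lerD // ler_wpM2r ?ip_ge0 // le_max lexx ?orbT.
apply: le_trans (lerD (Xr a) (Ys b)).
rewrite -big_split /=; apply: ler_sum => j _.
rewrite adjmx_block !adjmx0 !mul_block_col !mul0mx !addr0 !add0r !ip_col_mx.
lra.
Qed.

(** By [ip_addsqr_wt] the bound [r] grows to [(1 + t) r + (t + t^2) b], which stays inside the
    margin for small [t]. *)
Lemma adm_perturb n (X Y : 'I_g -> 'M[C]_n) : adm X ->
  exists2 t0, 0 < t0 &
    forall t, 0 < t <= t0 -> adm (fun j => X j + t%:C *: Y j).
Proof.
move=> [r /andP[r0 re] Xr].
have [b b0 Yb] : exists2 b : R, 0 <= b & forall v : 'cV_n,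
    \sum_j (ip (Y j *m v) (Y j *m v) + ip (Y j ^t* *m v) (Y j ^t* *m v))
      <= b * ip v v.
  have bj j : exists2 b : R, 0 <= b & forall v : 'cV_n,
      ip (Y j *m v) (Y j *m v) + ip (Y j ^t* *m v) (Y j ^t* *m v) <= b * ip v v.
    have [b1 b10 Y1] := opbounded_ex (Y j).
    have [b2 b20 Y2] := opbounded_ex (Y j ^t*).
    by exists (b1 + b2); rewrite ?addr_ge0 // => v; rewrite mulrDl lerD.
  have [b b0 Yb] := fin_all_exists2 bj.
  exists (\sum_j b j); first by rewrite sumr_ge0.
  by move=> v; rewrite big_distrl; apply: ler_sum => j _; exact: Yb.
(* [D] exceeds [eps ^+ 2], which forces [t <= 1], and then exceeds [r + b + t b], the growth rate of
   the bound. *)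
pose D := eps ^+ 2 + 2 * b + 1; pose t0 := (eps ^+ 2 - r) / D.
have D0 : 0 < D by rewrite /D; have := sqr_ge0 eps; lra.
have t0D : t0 * D = eps ^+ 2 - r by rewrite /t0 divfK // gt_eqF.
have t00 : 0 < t0 by rewrite /t0 divr_gt0 // subr_gt0.
exists t0 => // t /andP[tp tt0].
have tD : t * D <= eps ^+ 2 - r by rewrite -t0D ler_wpM2r // ltW.
have t1 : t <= 1 by move: tD; rewrite /D; nra.
exists ((1 + t) * r + (t + t ^+ 2) * b).
  apply/andP; split; first by nra.
  by move: tD; rewrite /D; nra.
move=> v; rewrite mulrDl -!mulrA.
apply: le_trans (lerD (ler_wpM2l _ (Xr v)) (ler_wpM2l _ (Yb v))); [|lra|nra].
rewrite !big_distrr -big_split /=; apply: ler_sum => j _.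
rewrite adjmxD adjmxZ !mulmxDl -!scalemxAl.
have -> : ((t%:C : C)^*)%R = t%:C by exact: conjc_real.
have arith x1 x2 a1 a2 b1 b2 :
    x1 <= (1 + t) * a1 + (t + t ^+ 2) * b1 ->
    x2 <= (1 + t) * a2 + (t + t ^+ 2) * b2 ->
    x1 + x2 <= (1 + t) * (a1 + a2) + (t + t ^+ 2) * (b1 + b2) by lra.
exact: arith (ip_addsqr_wt _ _ tp) (ip_addsqr_wt _ _ tp).
Qed.

End Admissible.

(** * Necessity *)

Section Reachable.
Variables (R : realType) (d g : nat).
Local Notation C := R[i].
Variables (K : 'M[C]_d) (c : 'cV[C]_d) (eps : R).
Hypotheses (hK : K ^t* = K) (K2 : K *m K = 1%:M) (eps0 : 0 < eps).
Implicit Type B : 'I_g -> 'M[C]_d.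

(** The pencil as a generalized Sylvester operator on coordinate matrices. *)
Definition syl B n (X : 'I_g -> 'M[C]_n) (W : 'M_(n, d)) : 'M_(n, d) :=
  W *m K^T - slam B X W - slam (adjfam B) (adjfam X) W.

Lemma Lambda_vecm B n (X : 'I_g -> 'M[C]_n) W :
  Lambda B X *m vecm W = vecm (slam B X W).
Proof.
rewrite slam.unlock mulmx_suml vecm_sum.
by apply: eq_bigr => j _; rewrite tens_vecm.
Qed.

Lemma pencil_vecm B n (X : 'I_g -> 'M[C]_n) W :
  pencil K B X *m vecm W = vecm (syl B X W).
Proof.
by rewrite !mulmxBl !Lambda_vecm tens_vecm mul1mx !vecmD !vecmN.
Qed.

Lemma syl_adj B n (X : 'I_g -> 'M[C]_n) W :
  syl (adjfam B) (adjfam X) W = syl B X W.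
Proof. by rewrite /syl (adjfamK B) (adjfamK X) addrAC. Qed.

(** A lower-left border [Y] couples the blocks twice: [Y] carries [U] down, and its adjoint carries
    [S] back up. *)
Lemma syl_block B n1 n2 (X : 'I_g -> 'M[C]_n1) (Y : 'I_g -> 'M_(n2, n1))
    (Z : 'I_g -> 'M_n2) U S :
  syl B (fun j => block_mx (X j) 0 (Y j) (Z j)) (col_mx U S) =
  col_mx (syl B X U - slam (adjfam B) (fun j => (Y j) ^t*) S)
         (syl B Z S - slam B Y U).
Proof.
rewrite /syl mul_col_mx slam_block.
have -> : adjfam (fun j => block_mx (X j) 0 (Y j) (Z j)) =
    fun j => block_mx (X j ^t*) ((Y j) ^t*) 0 (Z j ^t*).
  by apply: boolp.funext => j; rewrite /adjfam adjmx_block !adjmx0.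
rewrite slam_block !slam0l add0r addr0 !opp_col_mx !add_col_mx.
congr col_mx; first by rewrite opprD addrA.
by rewrite opprD !addrA [RHS]addrAC -!addrA; congr (_ + _); rewrite addrCA.
Qed.

Definition solvable B := forall n (X : 'I_g -> 'M[C]_n),
  adm eps X -> in_domain K B X.

Lemma solvable_adj B : solvable B -> solvable (adjfam B).
Proof.
move=> Bs n X Xa; rewrite /in_domain -(adjfamK X) pencil_adj.
by apply: Bs; exact: adm_adj.
Qed.

Definition unsyl B n (X : 'I_g -> 'M[C]_n) (Z : 'M_(n, d)) : 'M_(n, d) :=
  unvecm (Delta K B X *m vecm Z).

Lemma unsylK B n (X : 'I_g -> 'M[C]_n) :
  in_domain K B X -> cancel (unsyl B X) (syl B X).
Proof.
move=> BX Z; apply: (can_inj (@vecmK _ _ _)).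
by rewrite -pencil_vecm unvecmK mulmxA mulmxV ?mul1mx.
Qed.

Lemma sylK B n (X : 'I_g -> 'M[C]_n) :
  in_domain K B X -> cancel (syl B X) (unsyl B X).
Proof.
by move=> BX W; rewrite /unsyl -pencil_vecm mulmxA mulVmx // mul1mx vecmK.
Qed.

Lemma unsyl_linear B n (X : 'I_g -> 'M[C]_n) a Y Z :
  unsyl B X (a *: Y + Z) = a *: unsyl B X Y + unsyl B X Z.
Proof.
rewrite /unsyl vecmD vecmZ mulmxDr -scalemxAr.
by apply/matrixP => i j; rewrite !mxE.
Qed.

(* W lists the coordinates of Delta(X)(c *t xi) for some admissible X. *)
Definition reach B n (W : 'M[C]_(n, d)) : Prop :=
  exists2 X : 'I_g -> 'M[C]_n, adm eps X &
  exists xi : 'cV_n, syl B X W = xi *m c^T.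

Lemma reach_adj B n (W : 'M[C]_(n, d)) : reach B W -> reach (adjfam B) W.
Proof.
move=> [X Xa [xi XW]]; exists (adjfam X); first exact: adm_adj.
by exists xi; rewrite syl_adj.
Qed.

(** Direct sums make the row spaces of reachable matrices a directed family, whence a greatest one
    in [reach_max_ex]. *)
Lemma reach_dsum B n1 n2 (W : 'M[C]_(n1, d)) (V : 'M_(n2, d)) :
  reach B W -> reach B V -> reach B (col_mx W V).
Proof.
move=> [X Xa [xi XW]] [Y Ya [eta YV]].
exists (fun j => block_mx (X j) 0 0 (Y j)); first exact: adm_dsum.
exists (col_mx xi eta); rewrite syl_block mul_col_mx XW YV.
have -> : (fun j : 'I_g => (0 : 'M[C]_(n2, n1)) ^t*) = fun=> 0.
  by apply: boolp.funext => j; exact: adjmx0.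
by rewrite !slam0l !subr0.
Qed.

Lemma syl0 B n (W : 'M[C]_(n, d)) : syl B (fun=> 0) W = W *m K^T.
Proof.
rewrite /syl; have -> : adjfam (fun=> 0 : 'M[C]_n) = fun _ : 'I_g => 0.
  by apply: boolp.funext => j; exact: adjmx0.
by rewrite !slam0l !subr0.
Qed.

Lemma trmx_signature_sqr : K^T *m K^T = 1%:M.
Proof. by rewrite -trmx_mul K2 trmx1. Qed.

(** At [X = 0] with [n = 1], [Delta] is [K], and the reached vector is [K c]. *)
Lemma reach_c B : reach B (c^T *m K^T).
Proof.
exists (fun=> 0); first exact: adm0.
by exists 1%:M; rewrite mul1mx syl0 -mulmxA trmx_signature_sqr mulmx1.
Qed.

Definition reach_max B n (W : 'M[C]_(n, d)) : Prop :=
  reach B W /\ forall n' (V : 'M_(n', d)), reach B V -> (V <= W)%MS.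

Lemma reach_max_adj B n (W : 'M[C]_(n, d)) :
  reach_max B W -> reach_max (adjfam B) W.
Proof.
move=> [BW Bmax]; split=> [|n' V BV]; first exact: reach_adj.
by apply: Bmax; rewrite -(adjfamK B); exact: reach_adj.
Qed.

(** A reachable [V] outside the row space of [W] makes the rank of [col_mx W V] strictly larger;
    ranks are at most [d], so the induction is on the rank deficit. *)
Lemma reach_max_ex B : exists n (W : 'M[C]_(n, d)), reach_max B W.
Proof.
suff H m : forall n (W : 'M[C]_(n, d)), reach B W -> (d - \rank W <= m)%N ->
    exists n (W : 'M[C]_(n, d)), reach_max B W.
  by apply: (H d _ _ (reach_c B)); exact: leq_subr.
elim: m => [|m IH] n W BW Wm.
  exists n, W; split=> // n' V _; apply: submx_full.
  by rewrite /row_full eqn_leq rank_leq_col -subn_eq0 -leqn0.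
have [[n' [V [BV VW]]]|maxW] :=
    boolp.EM (exists n' (V : 'M[C]_(n', d)), reach B V /\ ~~ (V <= W)%MS).
  apply: (IH _ (col_mx W V)); first exact: reach_dsum.
  have : (\rank W < \rank (col_mx W V))%N.
    rewrite -addsmxE; apply: rank_ltmx; rewrite ltmxE addsmxSl /=.
    by apply: contra VW; apply: submx_trans; exact: addsmxSr.
  by move=> lt; rewrite -ltnS; apply: leq_trans Wm; rewrite ltn_sub2l //;
     apply: leq_trans lt (rank_leq_col _).
exists n, W; split=> // n' V BV; apply: contraPT maxW => VW.
by case; exists n', V.
Qed.

(** [X] is bordered by the row [t phi] at letter [j]. The new coordinate row [S] lies in the row
    space of [W] by maximality, and [s = S / t] solves [s = G + t^2 f(s)], where [G] is row [i] of
    [W (K B_j)^T]. [resolvent_submx] passes from these values of [t] to [t = 0]. *)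
Lemma reach_max_step B n (W : 'M[C]_(n, d)) j :
  solvable B -> reach_max B W -> (W *m (K *m B j)^T <= W)%MS.
Proof.
move=> Bs [[X Xa [xi XW]] Wmax].
apply/row_subP => i; rewrite row_mul rowE; set phi := delta_mx 0 i.
pose M := (K *m B j)^T; pose A := (B j ^t*)^T.
have XD := Bs _ _ Xa.
(* The feedback loop: up through the adjoint of the border, through [Delta(X)], and down through the
   border. *)
pose f (s : 'rV[C]_d) : 'rV_d := phi *m unsyl B X (phi ^t* *m s *m A) *m M.
have fL a u v : f (a *: u + v) = a *: f u + f v.
  rewrite /f mulmxDr -scalemxAr mulmxDl -scalemxAl unsyl_linear.
  by rewrite mulmxDr -scalemxAr mulmxDl -scalemxAl.
pose fl : {linear 'rV_d -> 'rV_d} :=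
  HB.pack f (GRing.isLinear.Build _ _ _ _ f fL).
pose Y (k : 'I_g) : 'M[C]_(n + 1) := block_mx 0 0 ((k == j)%:R *: phi) 0.
have [t0 t00 Yt] := adm_perturb Y (adm_dsum Xa (adm0 g 1 eps0)).
(* Infinitely many distinct admissible sizes. The parameter below is their square, as the loop
   crosses the border twice. *)
pose t k : R := t0 / k.+1%:R.
have t_gt0 k : 0 < t k by rewrite divr_gt0 ?ltr0n.
have t_le k : t k <= t0 by rewrite ler_pdivrMr ?ltr0n // ler_peMr ?ler1n // ltW.
apply: (@resolvent_submx _ _ _ _ (lin1_mx fl) _ (fun k => (t k ^+ 2)%:C)).
  move=> k l /complexI/eqP; rewrite eqrXn2 ?ltW // => /eqP tkl.
  have : (k.+1%:R : R) = l.+1%:R.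
    by apply: invr_inj; apply: (mulfI (lt0r_neq0 t00)).
  by move/eqP; rewrite eqr_nat => /eqP [].
move=> k; pose T : C := (t k)%:C.
have T0 : T != 0 by rewrite /T eq_complex /= eqxx andbT gt_eqF.
have T2 : (t k ^+ 2)%:C = T * T by rewrite expr2 rmorphM.
have Tconj : (T^*)%R = T by exact: conjc_real.
pose X' i : 'M[C]_(n + 1) := block_mx (X i) 0 ((i == j)%:R *: (T *: phi)) 0.
have X'a : adm eps X'.
  have -> : X' = fun i => block_mx (X i) 0 0 0 + T *: Y i.
    apply: boolp.funext => l.
    rewrite scale_block_mx add_block_mx !scaler0 !addr0 add0r.
    by rewrite /X' !scalerA [T * _]mulrC.
  by apply: Yt; rewrite t_gt0 t_le.
pose W' := unsyl B X' (col_mx (xi *m c^T) 0).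
have W'E := unsylK (Bs _ _ X'a) (col_mx (xi *m c^T) 0); rewrite -/W' in W'E.
have : (W' <= W)%MS.
  apply: Wmax; exists X' => //; exists (col_mx xi 0).
  by rewrite W'E mul_col_mx mul0mx.
move: W'E; rewrite -(vsubmxK W'); move: (usubmx W') (dsubmx W') => U S.
rewrite col_mx_sub syl_block syl0 => /eq_col_mx[top bot] /andP[_ SW].
(* The pencil acts on the new coordinate as [K] alone, inverted by [K *m K = 1]. *)
have SE : S = T *: (phi *m U *m M).
  move/eqP: bot; rewrite subr_eq0 slam_delta => /eqP bot.
  rewrite -[LHS]mulmx1 -trmx_signature_sqr mulmxA bot -!scalemxAl.
  by rewrite /M trmx_mul !mulmxA.
have UE : U = W + T *: unsyl B X (phi ^t* *m S *m A).
  rewrite -[LHS](sylK XD); move/eqP: top; rewrite subr_eq => /eqP ->.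
  have -> : (fun i => ((i == j)%:R *: (T *: phi)) ^t*) =
      fun i => (i == j)%:R *: (T *: phi ^t*).
    by apply: boolp.funext => l; rewrite !adjmxZ Tconj conjC_nat.
  rewrite slam_delta -XW addrC -!scalemxAl unsyl_linear (sylK XD).
  by rewrite addrC.
exists (T^-1 *: S); first exact: scalemx_sub.
rewrite mul_rV_lin1 /= /f T2 -scalerA.
have sE : T^-1 *: S = phi *m U *m M by rewrite SE scalerA mulVf // scale1r.
rewrite {1}sE UE mulmxDr mulmxDl; congr (_ + _).
rewrite -!scalemxAr -!scalemxAl; congr (_ *: _).
have unsylZ a Z : unsyl B X (a *: Z) = a *: unsyl B X Z.
  by rewrite /unsyl vecmZ -scalemxAr; apply/matrixP => p q; rewrite !mxE.
rewrite unsylZ -scalemxAr -scalemxAl scalerA (mulfV T0).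
by rewrite scale1r.
Qed.

(** Since [K (B_j K v) = (K B_j) (K v)], each letter costs one use of [reach_max_step]; adjoint
    letters use it for [adjfam B], for which the same [W] is maximal. *)
Lemma word_mx_sub B n (W : 'M[C]_(n, d)) w :
  solvable B -> reach_max B W ->
  ((word_mx K B w *m c)^T *m K^T <= W)%MS.
Proof.
move=> Bs Wmax; rewrite /word_mx; elim: w => [|l w IH].
  by rewrite big_nil mul1mx; apply: (Wmax.2); exact: reach_c.
have {IH} IH : ((word_mx K B w *m c)^T *m K^T <= W)%MS by [].
rewrite big_cons -/(word_mx K B w); set v := word_mx K B w *m c in IH *.
have step (A : 'M[C]_d) : (W *m (K *m A)^T <= W)%MS ->
    ((A *m K *m v)^T *m K^T <= W)%MS.
  move=> AW; apply: submx_trans AW; rewrite -trmx_mul.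
  have -> : (K *m (A *m K *m v))^T = (v^T *m K^T) *m (K *m A)^T.
    by rewrite -!trmx_mul !mulmxA.
  exact: submxMr.
rewrite -mulmxA -/v; case: l => j; apply: step; first exact: reach_max_step.
exact: (reach_max_step j (solvable_adj Bs) (reach_max_adj Wmax)).
Qed.

(** Any row [z] is the transpose of [K v] for [v = K z^T], and by minimality [v] is a combination of
    words applied to [c]. *)
Lemma reach_full B n (W : 'M[C]_(n, d)) :
  solvable B -> minimal K B c -> reach_max B W -> row_full W.
Proof.
move=> Bs Bmin Wmax; rewrite -sub1mx; apply/row_subP => i.
move: (row i _) => z; have [ws zws] := Bmin (z *m K^T)^T.
have -> : z = (z *m K^T)^T^T *m K^T.
  by rewrite trmxK -mulmxA trmx_signature_sqr mulmx1.
rewrite (coord_span (X := in_tuple _) zws) linear_sum mulmx_suml.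
apply: summx_sub => k _; rewrite linearZ -scalemxAl; apply: scalemx_sub.
have /mapP[w _ ->] : ([seq word_mx K B w *m c | w <- ws])`_k \in
    [seq word_mx K B w *m c | w <- ws] by rewrite mem_nth.
exact: word_mx_sub.
Qed.

(* On X (+) 0, with H carrying the first block to the second, only the term
   with the B_j survives, and Delta reduces to K on the second block. *)
Lemma compression_ge0 B n (W : 'M[C]_(n, d)) (x : 'I_g -> 'cV_d) :
  solvable B ->
  (forall n (X H : 'I_g -> 'M[C]_n), adm eps X ->
    psdmx (complex_hessian K B c X H)) ->
  reach B W -> row_full W ->
  0 <= ip (\sum_j B j *m x j) (K *m \sum_j B j *m x j).
Proof.
move=> Bs psdB [X Xa [xi XW]] Wfull; set v := \sum_j _.
(* Full rank of [W] is used here: the rows [phi j] of the direction [H] can produce any prescribed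
   vectors [x j]. *)
have [phi phiW] : exists phi : 'I_g -> 'rV_n, forall j, phi j *m W = (x j)^T.
  have phij j : exists p : 'rV_n, p *m W = (x j)^T.
    by have /submxP[p ->] := submx_full ((x j)^T) Wfull; exists p.
  by have [phi phiW] := fin_all_exists phij; exists phi.
pose X' j : 'M[C]_(n + 1) := block_mx (X j) 0 0 0.
pose H j : 'M[C]_(n + 1) := block_mx 0 0 (phi j) 0.
have X'a : adm eps X' by apply: adm_dsum => //; exact: adm0.
have X'D := Bs _ _ X'a.
have X'E U S : syl B X' (col_mx U S) = col_mx (syl B X U) (S *m K^T).
  rewrite syl_block syl0.
  have -> : (fun j : 'I_g => (0 : 'M[C]_(1, n)) ^t*) = fun=> 0.
    by apply: boolp.funext => j; exact: adjmx0.
  by rewrite !slam0l !subr0.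
have Delta_syl V : Delta K B X' *m vecm (syl B X' V) = vecm V.
  by rewrite -pencil_vecm mulmxA mulVmx ?mul1mx.
(* Supported on the first block, so that [Delta] sends [c *t z] to [W] there and to 0 on the added
   coordinate. *)
pose z : 'cV[C]_(1 * (n + 1)) := vecm (col_mx xi 0).
have uE : Delta K B X' *m (Cmx c (n + 1) *m z) = vecm (col_mx W 0).
  rewrite -Delta_syl X'E mul0mx XW; congr (_ *m _).
  by rewrite /z /Cmx tens_vecm mul1mx mul_col_mx mul0mx.
have vE : slam B phi W = v^T.
  rewrite slam.unlock linear_sum; apply: eq_bigr => j _.
  by rewrite phiW /= trmx_mul.
have LE : Lambda B H *m vecm (col_mx W 0) = vecm (col_mx 0 v^T).
  rewrite Lambda_vecm /H slam_block !slam0l !addr0.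
  by rewrite -vE.
(* The adjoint of [H] maps the second block to the first and so kills vectors supported on the
   first. *)
have LsE : Lambda (adjfam B) (adjfam H) *m vecm (col_mx W 0) = 0.
  rewrite Lambda_vecm.
  have -> : adjfam H = fun j => block_mx 0 ((phi j) ^t*) 0 0.
    by apply: boolp.funext => j; rewrite /adjfam adjmx_block !adjmx0.
  by rewrite slam_block !slam0l slam0r !addr0 col_mx0 vecm0.
have DLE : Delta K B X' *m vecm (col_mx 0 v^T) = vecm (col_mx 0 (K *m v)^T).
  rewrite -(Delta_syl (col_mx 0 (K *m v)^T)) X'E trmx_mul -mulmxA.
  rewrite trmx_signature_sqr mulmx1.
  have -> : syl B X 0 = 0 by rewrite /syl mul0mx !slam0r !subr0.
  by [].
have := psdmx_ip (psdB _ X' H X'a) z.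
rewrite (ip_hessian _ _ _ _ _ hK) /= uE LE LsE DLE mulmx0 ip0r addr0.
rewrite ip_vecm_row big_split_ord /= big1 ?add0r => [|k _].
  by rewrite big_ord1 !rowKd !row_id !trmxK.
by rewrite !rowKu !row0 trmx0 ip0r.
Qed.

End Reachable.

(** * Ranges, projections and the equivalence *)

Lemma famrngP (C : numClosedFieldType) d g (B : 'I_g -> 'M[C]_d) v :
  reflect (exists x : 'I_g -> 'cV_d, v = \sum_j B j *m x j)
    (v \in famrng B).
Proof.
apply: (iffP idP) => [/memv_sumP[u uB ->]|[x ->]].
  have uE j : exists x : 'cV_d, u j = B j *m x.
    have /memv_imgP[x _ ->] := uB j isT.
    by exists x; rewrite lfunE.
  have [x xE] := fin_all_exists uE.
  by exists x; apply: eq_bigr => j _.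
apply: memv_sumr => j _; apply/memv_imgP; exists (x j); first exact: memvf.
by rewrite lfunE.
Qed.

Lemma orthoproj_famrng (C : numClosedFieldType) d g (B : 'I_g -> 'M[C]_d)
    (P : 'M[C]_d) : is_orthoproj P (famrng B) ->
  [/\ P ^t* = P, P *m P = P, forall j, P *m B j = B j &
   forall v, exists x : 'I_g -> 'cV_d, P *m v = \sum_j B j *m x j].
Proof.
move=> [+ P2 PB]; rewrite hermsymmxE => /eqP hP; split=> // [j|v].
  apply/matrixP => i k.
  have /memv_imgP[y _ yE] : col k (B j) \in mxrng P.
    rewrite PB; apply/famrngP; exists (fun l => (l == j)%:R *: delta_mx k 0).
    rewrite (bigD1 j) //= big1 ?addr0 ?eqxx ?scale1r ?colE // => l /negPf ->.
    by rewrite scale0r mulmx0.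
  rewrite lfunE /= in yE.
  have : P *m col k (B j) = col k (B j) by rewrite yE mulmxA P2.
  by rewrite colE mulmxA -!colE => /colP/(_ i); rewrite !mxE.
apply/famrngP; rewrite -PB; apply/memv_imgP; exists v; first exact: memvf.
by rewrite lfunE.
Qed.

Theorem theorem1p4 (R : realType) (d g : nat) (K : 'M[R[i]]_d)
    (B : 'I_g -> 'M[R[i]]_d) (c : 'cV[R[i]]_d) (P Pstar : 'M[R[i]]_d)
    (hK : signature_mx K) (hmin : minimal K B c)
    (hP : is_orthoproj P (famrng B))
    (hPstar : is_orthoproj Pstar (famrng (adjfam B))) :
  plush_near0 K B c <->
  psdmx (P *m K *m P) /\ psdmx (Pstar *m K *m Pstar).
Proof.
have [+ K2] := hK; rewrite hermsymmxE => /eqP/esym Kh.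
have [Ph P2 PB Prng] := orthoproj_famrng hP.
have [Psh Ps2 PsB Psrng] := orthoproj_famrng hPstar.
split=> [[eps [eps0 dom psdH]]|[psdP psdPs]]; last first.
  by apply: (@plush_of_compressions _ _ _ _ Kh K2 _ _ P Pstar) => //;
     exact: psdmx_ip.
have Bs : solvable K eps B by move=> n X /adm_free_ball/dom.
have Bpsd n (X H : 'I_g -> 'M[R[i]]_n) : adm eps X ->
    psdmx (complex_hessian K B c X H) by move=> /adm_free_ball; exact: psdH.
(* One reachable [W] of full rank serves both compressions, since it is reachable for [adjfam B]
   too. *)
have [n [W Wmax]] := reach_max_ex c K2 eps0 B.
have Wfull := reach_full K2 eps0 Bs hmin Wmax.
have compression_psd (Q : 'M[R[i]]_d) : Q ^t* = Q ->
    (forall v, 0 <= ip (Q *m v) (K *m (Q *m v))) -> psdmx (Q *m K *m Q).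
  move=> hQ QK; apply: ip_psdmx => [|v].
    by rewrite hermsymmxE !adjmx_mul hQ Kh mulmxA.
  by rewrite -!mulmxA -{1}hQ -ip_mull.
split; apply: compression_psd => // v.
  have [x ->] := Prng v.
  exact: (compression_ge0 Kh K2 eps0 x Bs Bpsd Wmax.1 Wfull).
have [x ->] := Psrng v.
have Bs' := solvable_adj Bs.
have BW' := reach_adj Wmax.1.
apply: (@compression_ge0 R d g K c eps Kh K2 eps0 (adjfam B) n W x
                         Bs' _ BW' Wfull).
move=> m X H Xa; rewrite -(adjfamK X) -(adjfamK H) complex_hessian_adj.
by apply: Bpsd; exact: adm_adj.
Qed.
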